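(* Let $g\in\,]0,1[$, $\alpha\in\,]0,1]$, $\ell>1$, $a>0$, $c\ge 0$ be constants. For each $n$ consider a homogeneous rumor spreading process on $n$ nodes with success probabilities $p_k$ and covariance numbers $c_k$, and suppose that for all sufficiently large $n$ and all integers $u\in[n^{1-\alpha},gn]$, (i) $1-p_{n-u}\ge a\left(\frac{u}{n}\right)^{\ell-1}$, and (ii) $c_{n-u}\le c\,\frac{n}{u^2}$. Then $\mathbb{E}[T(n-\lfloor gn\rfloor,\,n-\lfloor n^{1-\alpha}\rfloor)]\ge\log_\ell\ln n-O(1)$, and for every sufficiently large constant $r$ (possibly depending on $\alpha$), $\Pr[T(n-\lfloor gn\rfloor,\,n-\lfloor n^{1-\alpha}\rfloor)\le\log_\ell\ln n-r]\le O(n^{-1+2\alpha\ell})$.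
   Context: Homogeneous rumor spreading process on $n$ nodes: time proceeds in rounds $1,2,\dots$. Each node is informed or uninformed; informed nodes stay informed; the process starts with exactly one informed node. The process is memoryless: the joint law of the set of nodes newly informed in a round depends only on the set of nodes informed at the beginning of that round. Moreover, in any round starting with exactly $k$ informed nodes, each uninformed node becomes informed in that round with probability exactly $p_k$, a number depending only on $k$ (and on the process and $n$). The covariance number $c_k$ ($1\le k\le n-1$) is the smallest number such that, whenever a round starts with $k$ informed nodes, for any two distinct uninformed nodes $x_1,x_2$ the indicator random variables $X_1,X_2$ of the events that these nodes become informed in this round satisfy $\mathrm{Cov}[X_1,X_2]\le c_k$ (upper bounds on $c_{n-1}$ are vacuous). $T(k,m)$ (with $k\le m\le n$) denotes the number of rounds it takes, starting from a moment at which exactly $k$ nodes are informed, until at least $m$ nodes are informed. One has one process for each $n$; the constants implicit in $O(\cdot)$ are independent of $n$, and the statements are for all sufficiently large $n$. *)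

(* Defs.v *)
From HB Require Import structures.
From mathcomp Require Import all_boot all_order all_algebra.
From mathcomp Require Import all_classical all_reals all_analysis.

Set Implicit Arguments.
Unset Strict Implicit.
Unset Printing Implicit Defensive.

Import Order.TTheory GRing.Theory Num.Theory.

Local Open Scope classical_set_scope.
Local Open Scope ring_scope.

(* A homogeneous rumor spreading process on the nodes 'I_n, given by its
   one-round law: [round_law S S'] is the probability that a round starting
   with set of informed nodes S ends with set of informed nodes S' (so that
   S' :\: S is the set of newly informed nodes). That this law is a function of
   S alone is the memorylessness of the process.
   [success_prob k] is p_k; it is meaningful for 1 <= k <= n - 1 only, where
   [homogeneous] determines it. *)
Record rumor_process (R : realType) (n : nat) := RumorProcess {
  round_law : {set 'I_n} -> {set 'I_n} -> R ;
  success_prob : nat -> R ;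
  round_law_ge0 : forall S S', 0 <= round_law S S' ;
  round_law_sum1 : forall S, \sum_(S' : {set 'I_n}) round_law S S' = 1 ;
  stay_informed : forall S S' : {set 'I_n}, ~~ (S \subset S') -> round_law S S' = 0 ;
  homogeneous : forall (S : {set 'I_n}) (x : 'I_n), S != finset.set0 ->
    x \notin S ->
    \sum_(S' : {set 'I_n} | x \in S') round_law S S' = success_prob #|S| }.

Definition round_mean (R : realType) (n : nat) (Q : rumor_process R n)
    (S : {set 'I_n}) (f : {set 'I_n} -> R) : R :=
  \sum_(S' : {set 'I_n}) round_law Q S S' * f S'.

Definition round_cov (R : realType) (n : nat) (Q : rumor_process R n)
    (S : {set 'I_n}) (f g : {set 'I_n} -> R) : R :=
  round_mean Q S
    (fun S' => (f S' - round_mean Q S f) * (g S' - round_mean Q S g)).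

Definition informed_ind (R : realType) (n : nat) (x : 'I_n)
  (S' : {set 'I_n}) : R := (x \in S')%:R.

(* The least upper bound is taken in \bar R: for k = n - 1 there are no two
   distinct uninformed nodes, the value is -oo, and every upper bound on it
   holds. For 1 <= k <= n - 2 it is the maximum of finitely many reals. *)
Definition covariance_number (R : realType) (n : nat) (Q : rumor_process R n)
    (k : nat) : \bar R :=
  ereal_sup [set v : \bar R | exists S : {set 'I_n}, exists x1 x2 : 'I_n,
    [/\ #|S| = k, x1 \notin S, x2 \notin S, x1 != x2 &
        v = (round_cov Q S (informed_ind R x1) (informed_ind R x2))%:E]].

(* [X t] is the random set of nodes informed after t rounds, the count starting
   from a moment at which exactly k nodes are informed. The law of the
   k-element set [X 0] is arbitrary: it can be concentrated on one set, or be
   the conditional law of the informed set of an execution started from a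
   single node, given that k nodes are informed at the end of some round. *)
Record rumor_run (R : realType) (n : nat) (Q : rumor_process R n) (k : nat)
    (d : measure_display) (Omega : measurableType d) (P : probability Omega R)
    (X : nat -> Omega -> {set 'I_n}) : Prop := RumorRun {
  run_measurable : forall (t : nat) (S : {set 'I_n}),
    measurable [set w | X t w = S] ;
  run_start : P [set w | #|X 0%N w| = k] = 1%E ;
  run_step : forall (t : nat) (s : nat -> {set 'I_n}),
    P [set w | forall i : nat, (i <= t.+1)%N -> X i w = s i] =
    (P [set w | forall i : nat, (i <= t)%N -> X i w = s i] *
      (round_law Q (s t) (s t.+1))%:E)%E }.

(* T(k, m) along a run started with k informed nodes; +oo if there are never m
   informed nodes. *)
Definition spread_time (R : realType) (n : nat) (Omega : Type)
    (X : nat -> Omega -> {set 'I_n}) (m : nat) (w : Omega) : \bar R :=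
  ereal_inf [set (t%:R)%:E | t in [set t : nat | (m <= #|X t w|)%N]].

Definition logb (R : realType) (b x : R) : R := ln x / ln b.

(* Main.v *)
Require Import Defs.
From HB Require Import structures.
From mathcomp Require Import all_boot all_order all_algebra.
From mathcomp Require Import all_classical all_reals all_analysis.
From mathcomp Require Import measurable_realfun ring lra.

Import Order.TTheory GRing.Theory Num.Theory.

Local Open Scope classical_set_scope.
Local Open Scope ring_scope.

(* If a fraction x of the nodes is uninformed at the beginning of a round, then
   by (i) and (ii) and Chebyshev's inequality the fraction afterwards is at
   least (a / 2) x^ell, up to a failure probability O(x^(-2 ell) / n). Iterating,
   after t rounds the fraction is still at least exp(- A ell^t) for a constant
   A, and the failure probabilities of the first t rounds add up to
   O(exp((2 A + 1) ell^t) / n). For t <= log_ell (ln n) - r this is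
   O(n^(-1 + eps)), with eps as small as we like once r is large. *)

(** * Mean and covariance in one round, and Chebyshev's inequality *)

Lemma round_mean_informed_ind (R : realType) (n : nat) (Q : rumor_process R n)
    (S : {set 'I_n}) (x : 'I_n) :
  S != finset.set0 -> x \notin S ->
  round_mean Q S (informed_ind R x) = success_prob Q #|S|.
Proof.
move=> S0 xS; rewrite -(homogeneous Q S0 xS) /round_mean [RHS]big_mkcond /=.
apply: eq_bigr => S' _; rewrite /informed_ind.
by case: ifP => _; rewrite ?mulr1 ?mulr0.
Qed.

Lemma round_mean_le (R : realType) (n : nat) (Q : rumor_process R n)
    (S : {set 'I_n}) (f h : {set 'I_n} -> R) :
  (forall S', f S' <= h S') -> round_mean Q S f <= round_mean Q S h.
Proof. by move=> fh; apply: ler_sum => S' _; rewrite ler_wpM2l// round_law_ge0. Qed.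

Lemma round_mean_cst (R : realType) (n : nat) (Q : rumor_process R n)
    (S : {set 'I_n}) (b : R) : round_mean Q S (fun=> b) = b.
Proof. by rewrite /round_mean -mulr_suml round_law_sum1 mul1r. Qed.

Lemma round_mean_itv01 (R : realType) (n : nat) (Q : rumor_process R n)
    (S : {set 'I_n}) (x : 'I_n) : 0 <= round_mean Q S (informed_ind R x) <= 1.
Proof.
by rewrite -{1}(round_mean_cst _ _ Q S 0) -(round_mean_cst _ _ Q S 1);
  apply/andP; split; apply: round_mean_le => S'; rewrite /informed_ind; case: (_ \in _).
Qed.

Lemma round_cov_self_le1 (R : realType) (n : nat) (Q : rumor_process R n)
    (S : {set 'I_n}) (x : 'I_n) :
  round_cov Q S (informed_ind R x) (informed_ind R x) <= 1.
Proof.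
have /andP[m0 m1] := round_mean_itv01 _ _ Q S x.
rewrite -[leRHS](round_mean_cst _ _ Q S); apply: round_mean_le => S'.
by rewrite {1 3}/informed_ind; case: (_ \in _) => /=; nra.
Qed.

(** The number of nodes that stay uninformed has mean at least [mu], so falling below [mu / 2] is a
    deviation of more than [mu / 2]. Its variance is the sum of all pairwise covariances, where
    diagonal terms are at most 1 and the others at most [v]. *)
Lemma few_uninformed_prob (R : realType) (n : nat) (Q : rumor_process R n)
    (S : {set 'I_n}) (mu v : R) :
  S != finset.set0 -> 0 < mu -> 0 <= v ->
  mu <= #|finset.setC S|%:R * (1 - success_prob Q #|S|) ->
  (covariance_number Q #|S| <= v%:E)%E ->
  \sum_(S' : {set 'I_n} | #|finset.setC S'|%:R < mu / 2) round_law Q S S' <=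
    4 * (#|finset.setC S|%:R + #|finset.setC S|%:R ^+ 2 * v) / mu ^+ 2.
Proof.
move=> S0 mu0 v0 muM covS; set U := finset.setC S; set p := success_prob Q #|S|.
(* The centred number of newly informed nodes; up to sign, it is also the deviation of the number of
   nodes that stay uninformed. *)
pose D (S' : {set 'I_n}) : R := \sum_(x in U) (informed_ind R x S' - p).
have var : round_mean Q S (fun S' => D S' ^+ 2) <= #|U|%:R + #|U|%:R ^+ 2 * v.
  have -> : round_mean Q S (fun S' => D S' ^+ 2) =
      \sum_(x in U) \sum_(y in U)
         round_cov Q S (informed_ind R x) (informed_ind R y).
    rewrite /round_mean.
    under eq_bigr => S' _ do rewrite expr2 {1}/D mulr_suml mulr_sumr.
    rewrite exchange_big; apply: eq_bigr => x; rewrite inE => xS.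
    under eq_bigr => S' _ do rewrite /D mulr_sumr mulr_sumr.
    rewrite exchange_big; apply: eq_bigr => y; rewrite inE => yS.
    rewrite /round_cov !round_mean_informed_ind//.
  have le_cov (x y : 'I_n) : x \in U -> y \in U ->
      round_cov Q S (informed_ind R x) (informed_ind R y) <= (x == y)%:R + v.
    rewrite !inE => xS yS; case: (eqVneq x y) => [->|xy].
      by rewrite (le_trans (round_cov_self_le1 _ _ Q S y))// lerDl.
    rewrite add0r -lee_fin (le_trans _ covS)//; apply: ereal_sup_ubound.
    by exists S, x, y.
  apply: le_trans (_ : \sum_(x in U) \sum_(y in U) ((x == y)%:R + v) <= _).
    by apply: ler_sum => x xU; apply: ler_sum => y yU; exact: le_cov.
  rewrite (eq_bigr (fun=> 1 + #|U|%:R * v)); last first.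
    move=> x xU; rewrite big_split /= sumr_const mulr_natl; congr (_ + _).
    rewrite (bigD1 x)//= eqxx big1 ?addr0// => y /andP[_ yx].
    by rewrite eq_sym (negbTE yx).
  by rewrite sumr_const -[leLHS]mulr_natl mulrDr mulr1 mulrA expr2.
(* Markov's inequality for the square of [D], term by term: [mu ^+ 2 <= 4 * D S' ^+ 2] on the sets
   [S'] counted on the left, and the other terms are nonnegative. *)
rewrite ler_pdivlMr ?exprn_gt0// (le_trans _ (ler_wpM2l _ var))//.
rewrite mulr_suml /round_mean mulr_sumr big_mkcond /=; apply: ler_sum => S' _.
case: ifP => [fewS'|_]; last first.
  by apply: mulr_ge0 => //; apply: mulr_ge0; [exact: round_law_ge0|exact: sqr_ge0].
rewrite [leRHS]mulrCA ler_wpM2l ?round_law_ge0//.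
have DE : D S' = #|U|%:R * (1 - p) - #|U :\: S'|%:R.
  rewrite /D big_split /= sumrN sumr_const -[p *+ _]mulr_natl -(cardsID S' U) natrD.
  have <- : \sum_(x in U) informed_ind R x S' = #|U :&: S'|%:R.
    rewrite -sum1_card natr_sum big_mkcond [RHS]big_mkcond /=.
    by apply: eq_bigr => x _; rewrite finset.in_setI /informed_ind; do 2 case: (x \in _).
  ring.
have : #|U :\: S'|%:R <= #|finset.setC S'|%:R :> R.
  by rewrite ler_nat subset_leq_card// finset.subDset finset.setUCr finset.subsetT.
rewrite DE; move: muM fewS'; set M := _ * _; rewrite expr2; nra.
Qed.

(** * Events of a run and the union bound over rounds *)

Lemma measurable_finite_preimage d (Omega : measurableType d) (F : finType)
    (Z : Omega -> F) (B : pred F) :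
  (forall f, measurable [set w | Z w = f]) -> measurable [set w | B (Z w)].
Proof.
move=> mZ; have -> : [set w | B (Z w)] = \bigcup_(f in [set f | B f]) [set w | Z w = f].
  by apply/seteqP; split => w /=; [move=> Bw; exists (Z w)|move=> [f Bf ->]].
by apply: fin_bigcup_measurable => // f _.
Qed.

Lemma probability_finite_preimage d (Omega : measurableType d) (R : realType)
    (P : probability Omega R) (F : finType) (Z : Omega -> F) (B : pred F) :
  (forall f, measurable [set w | Z w = f]) ->
  P [set w | B (Z w)] = (\sum_(f | B f) P [set w | Z w = f])%E.
Proof.
move=> mZ; have -> : [set w | B (Z w)] = \bigcup_(f in [set f | B f]) [set w | Z w = f].
  by apply/seteqP; split => w /=; [move=> Bw; exists (Z w)|move=> [f Bf ->]].
rewrite measure_fin_bigcup//; [|exact: finite_finset|by move=> f f' _ _ [w [/= <- <-]]].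
by rewrite [RHS]bigfs ?index_enum_uniq// => f _; rewrite mem_index_enum.
Qed.

Lemma run_path_measurable (R : realType) (n : nat) (Q : rumor_process R n)
    (k : nat) (d : measure_display) (Omega : measurableType d)
    (P : probability Omega R) (X : nat -> Omega -> {set 'I_n})
    (t : nat) (s : nat -> {set 'I_n}) : rumor_run Q k P X ->
  measurable [set w | forall i : nat, (i <= t)%N -> X i w = s i].
Proof.
move=> HX; have -> : [set w | forall i : nat, (i <= t)%N -> X i w = s i] =
  \bigcap_(i in [set i : nat | (i <= t)%N]) [set w | X i w = s i] by [].
by apply: bigcap_measurableType => i _; exact: run_measurable HX _ _.
Qed.

(** Since [run_step] speaks of whole histories only, the event is split over the finitely many
    histories up to time [t] that end in [G]. Each contributes at most [delta] times its own
    probability, and these probabilities add up to at most 1. *)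
Lemma run_bad_step_le (R : realType) (n : nat) (Q : rumor_process R n)
    (k : nat) (d : measure_display) (Omega : measurableType d)
    (P : probability Omega R) (X : nat -> Omega -> {set 'I_n})
    (t : nat) (G G' : pred {set 'I_n}) (delta : R) : rumor_run Q k P X ->
  0 <= delta ->
  (forall S, G S -> \sum_(S' | ~~ G' S') round_law Q S S' <= delta) ->
  (P [set w | G (X t w) && ~~ G' (X t.+1 w)] <= delta%:E)%E.
Proof.
move=> HX delta0 Hdelta.
pose path w := [ffun i : 'I_t.+1 => X i w].
(* A finite history followed by [S'], extended to all times as [run_step] requires; the values after
   time [t.+1] are irrelevant, and up to time [t] so is [S']. *)
pose ext (f : {ffun 'I_t.+1 -> {set 'I_n}}) S' (i : nat) :=
  if (i <= t)%N then f (inord i) else S'.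
have pathE f S' : [set w | path w = f] =
    [set w | forall i : nat, (i <= t)%N -> X i w = ext f S' i].
  apply/seteqP; split => w /=.
    by move=> <- i it; rewrite /ext it ffunE inordK.
  move=> H; apply/ffunP => i; rewrite ffunE H -1?ltnS// /ext -ltnS ltn_ord.
  by congr (f _); apply/val_inj => /=; rewrite inordK.
have stepE f S' : [set w | (path w, X t.+1 w) = (f, S')] =
    [set w | forall i : nat, (i <= t.+1)%N -> X i w = ext f S' i].
  apply/seteqP; split => w /=.
    move=> [<- <-] i; rewrite leq_eqVlt => /predU1P[->|].
      by rewrite /ext ltnn.
    by rewrite ltnS => it; rewrite /ext it ffunE inordK.
  move=> H; congr (_, _); last by rewrite H// /ext ltnn.
  by have := pathE f S'; move/seteqP => [_ /(_ w)]; apply => i it; apply: H; exact: leqW.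
have mpath f : measurable [set w | path w = f].
  by rewrite (pathE _ finset.set0); exact: run_path_measurable HX.
have mstep g : measurable [set w | (path w, X t.+1 w) = g].
  by case: g => f S'; rewrite stepE; exact: run_path_measurable HX.
pose B (g : {ffun 'I_t.+1 -> {set 'I_n}} * {set 'I_n}) := G (g.1 ord_max) && ~~ G' g.2.
have -> : [set w | G (X t w) && ~~ G' (X t.+1 w)] = [set w | B (path w, X t.+1 w)].
  by apply/seteqP; split => w /=; rewrite /B ffunE.
rewrite probability_finite_preimage//.
rewrite (eq_bigr (fun p => P [set w | (path w, X t.+1 w) = (p.1, p.2)])); last by case.
rewrite -(pair_big_dep (fun f : {ffun 'I_t.+1 -> {set 'I_n}} => G (f ord_max))
  (fun f (S' : {set 'I_n}) => ~~ G' S')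
  (fun f S' => P [set w | (path w, X t.+1 w) = (f, S')])) /=.
apply: (@le_trans _ _ (\sum_(f : {ffun 'I_t.+1 -> {set 'I_n}} | G (f ord_max))
  delta%:E * P [set w | path w = f])%E).
  apply: lee_sum => f Gf.
  under eq_bigr => S' _ do rewrite stepE (run_step HX) -pathE /ext leqnn ltnn.
  rewrite -ge0_sume_distrr; last by move=> S' _; rewrite lee_fin round_law_ge0.
  rewrite muleC; apply: lee_wpmul2r => //; rewrite sumEFin lee_fin.
  apply: Hdelta; suff -> : inord t = ord_max :> 'I_t.+1 by [].
  by apply/val_inj => /=; rewrite inordK.
rewrite -ge0_sume_distrr//.
rewrite -[leRHS]mule1; apply: lee_wpmul2l => //.
rewrite -(probability_finite_preimage _ _ _ _ _ path (fun f => G (f ord_max)))//.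
apply: probability_le1.
exact: (measurable_finite_preimage _ _ _ path (fun f => G (f ord_max))).
Qed.

(** On [A], either [G] fails at time 0, which has probability 0 by [run_start], or some round starts
    inside [G] and ends outside. A union bound over the [T] rounds concludes. *)
Lemma run_leave_le (R : realType) (n : nat) (Q : rumor_process R n)
    (k : nat) (d : measure_display) (Omega : measurableType d)
    (P : probability Omega R) (X : nat -> Omega -> {set 'I_n})
    (T : nat) (G : nat -> pred {set 'I_n}) (delta : R) (A : set Omega) :
  rumor_run Q k P X -> measurable A ->
  (forall w, A w -> exists2 t, (t <= T)%N & ~~ G t (X t w)) ->
  0 <= delta ->
  (forall S : {set 'I_n}, #|S| = k -> G 0%N S) ->
  (forall t (S : {set 'I_n}), (t < T)%N -> G t S ->
    \sum_(S' | ~~ G t.+1 S') round_law Q S S' <= delta) ->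
  (P A <= (T%:R * delta)%:E)%E.
Proof.
move=> HX mA leaveA delta0 G0 Gstep.
have mG t (B : pred {set 'I_n}) : measurable [set w | B (X t w)].
  by apply: (measurable_finite_preimage _ _ _ (X t) B) => S; exact: run_measurable HX _ _.
have mG2 t (B B' : pred {set 'I_n}) : measurable [set w | B (X t w) && B' (X t.+1 w)].
  rewrite [X in measurable X](_ : _ = [set w | B (X t w)] `&` [set w | B' (X t.+1 w)]).
    exact: measurableI.
  by apply/seteqP; split => w /=; [move/andP|move=> /andP].
have P0 : P [set w | ~~ G 0%N (X 0%N w)] = 0%E.
  apply/eqP; rewrite eq_le measure_ge0 andbT.
  have mk : measurable [set w | #|X 0%N w| = k].
    rewrite [X in measurable X](_ : _ = [set w | #|X 0%N w| == k]).
      exact: (mG 0%N (fun S => #|S| == k)).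
    by apply/seteqP; split => w /= /eqP.
  rewrite (@le_trans _ _ (P (~` [set w | #|X 0%N w| = k])))//.
    apply: le_measure; rewrite ?inE; [exact: (mG 0%N (predC (G 0%N)))|exact: measurableC|].
    by move=> w /= nG /G0; apply/negP.
  by rewrite probability_setC// (run_start HX) subee.
pose E t := [set w | G t (X t w) && ~~ G t.+1 (X t.+1 w)].
have mU t : measurable (E t) by exact: (mG2 t _ (predC (G t.+1))).
apply: (@le_trans _ _ (P ([set w | ~~ G 0%N (X 0%N w)] `|`
  \big[setU/set0]_(t < T) E t))).
  apply: le_measure; rewrite ?inE//.
  - apply: measurableU; first exact: (mG 0%N (predC (G 0%N))).
    exact: bigsetU_measurable.
  (* Going back in time from a failure of [G], one meets either a round that leaves [G] or a failure
     at time 0. *)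
  - move=> w /leaveA[t]; elim: t => [_ ?|t IH tT nG]; first by left.
    case: (boolP (G t (X t w))) => Gt; last by apply: IH => //; exact: ltnW.
    by right; rewrite -bigcup_mkord; exists t => //; rewrite /E /= Gt.
apply: le_trans (measureU2 _ _ _) _; [exact: (mG 0%N (predC (G 0%N)))|exact: bigsetU_measurable|].
apply: (@le_trans _ _ (0 + \sum_(t < T) delta%:E)%E); last first.
  by rewrite add0e sumEFin lee_fin sumr_const card_ord mulr_natl.
apply: leeD; first by rewrite -P0.
apply: (le_trans (@Boole_inequality _ _ _ P E T (fun t _ => mU t))).
by apply: lee_sum => t _; apply: run_bad_step_le HX _ _ => // S; exact: Gstep.
Qed.

(** * The spreading time as an extended real random variable *)

Lemma spread_time_le (R : realType) (n : nat) (Omega : Type)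
    (X : nat -> Omega -> {set 'I_n}) (m : nat) (w : Omega) (b : R) :
  (spread_time R X m w <= b%:E)%E <->
  exists2 t : nat, t%:R <= b & (m <= #|X t w|)%N.
Proof.
split=> [sb|[t tb mt]]; last first.
  by apply: ge_ereal_inf; exists t%:R%:E; [exists t|rewrite lee_fin].
apply: contrapT => nt.
(* With [N] the least natural number above [b], the times that are not at most [b] are all at least
   [N], so their infimum is still above [b]. A negative [b] is treated apart because [Num.truncn]
   sends it to 0, which would give 1 instead of 0. *)
have [N bN minN] : exists2 N : nat, b < N%:R & forall t : nat, b < t%:R -> (N <= t)%N.
  have [b0|b0] := ltP b 0; first by exists 0%N.
  exists (Num.truncn b).+1; first exact: truncnS_gt.
  by move=> t; rewrite truncn_lt_nat.
move: sb; apply/negP; rewrite -ltNge.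
apply: (@lt_le_trans _ _ N%:R%:E); first by rewrite lte_fin.
apply/ereal_infP => _ [t mt <-]; rewrite lee_fin ler_nat minN// ltNge.
by apply/negP => tb; apply: nt; exists t.
Qed.

Lemma spread_time_le_measurable (R : realType) (n : nat) (Q : rumor_process R n)
    (k : nat) (d : measure_display) (Omega : measurableType d)
    (P : probability Omega R) (X : nat -> Omega -> {set 'I_n})
    (m : nat) (b : R) : rumor_run Q k P X ->
  measurable [set w | (spread_time R X m w <= b%:E)%E].
Proof.
move=> HX; rewrite [X in measurable X](_ : _ =
    \bigcup_(t in [set t : nat | t%:R <= b]) [set w | (m <= #|X t w|)%N]).
  apply: bigcup_measurable => t _.
  apply: (measurable_finite_preimage _ _ _ (X t) (fun S => (m <= #|S|)%N)) => S.
  exact: run_measurable HX _ _.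
by apply/seteqP; split => w /= => [/spread_time_le|?]; [|apply/spread_time_le].
Qed.

Lemma spread_time_measurable (R : realType) (n : nat) (Q : rumor_process R n)
    (k : nat) (d : measure_display) (Omega : measurableType d)
    (P : probability Omega R) (X : nat -> Omega -> {set 'I_n})
    (m : nat) : rumor_run Q k P X ->
  measurable_fun setT (spread_time R X m).
Proof.
move=> HX; apply: (measurability _ (ErealGenOInfty.measurableE R)) => //.
move=> _ [_ [b ->] <-]; rewrite setTI.
rewrite [X in measurable X](_ : _ = ~` [set w | (spread_time R X m w <= b%:E)%E]).
  exact/measurableC/spread_time_le_measurable/HX.
apply/seteqP; split => w /=; rewrite in_itv /= andbT ltNge.
  by move/negP.
by move/negP.
Qed.

(** * One round, with the uninformed fraction on a logarithmic scale *)

Lemma expR_powR_ln (R : realType) (x y : R) : 0 < x -> x `^ y = expR (y * ln x).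
Proof. by move=> x0; rewrite /powR gt_eqF. Qed.

Lemma bernoulli_ineq (R : realType) (x : R) (t : nat) :
  1 < x -> 1 + t%:R * (x - 1) <= x ^+ t.
Proof.
move=> x1; elim: t => [|t IH]; first by rewrite mul0r addr0 expr0.
have t0 : 0 <= t%:R :> R by [].
have x0 : 0 <= x by lra.
rewrite exprS -natr1; apply: le_trans (ler_wpM2l x0 IH).
have : 0 <= t%:R * (x - 1) ^+ 2 by rewrite mulr_ge0// sqr_ge0.
by rewrite expr2; lra.
Qed.

(** With u uninformed nodes, (i) makes the mean at least n a (u/n)^ell, hence at least mu = n a
    exp(- ell z), and (ii) makes the variance at most u + c n <= (1 + c) n. The bound is Chebyshev's
    4 (1 + c) n / mu^2. *)
Lemma one_round_few_uninformed_prob (R : realType) (n : nat)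
    (Q : rumor_process R n) (S : {set 'I_n}) (ell a c z : R) :
  1 < ell -> 0 < a -> 0 <= c -> S != finset.set0 ->
  expR (- z) <= #|finset.setC S|%:R / n%:R ->
  1 - success_prob Q #|S| >= a * (#|finset.setC S|%:R / n%:R) `^ (ell - 1) ->
  (covariance_number Q #|S| <= (c * (n%:R / #|finset.setC S|%:R ^+ 2))%:E)%E ->
  \sum_(S' : {set 'I_n} | #|finset.setC S'|%:R < n%:R * (a / 2 * expR (- (ell * z))))
      round_law Q S S' <=
    4 * (1 + c) / a ^+ 2 / n%:R * expR (2 * (ell * z)).
Proof.
move=> ell1 a0 c0 S0; set u : R := #|_|%:R => zu pS covS.
have n0 : 0 < n%:R :> R.
  by have /finset.set0Pn[x _] := S0; rewrite ltr0n; apply: leq_ltn_trans (ltn_ord x).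
have u0 : 0 < u by have := lt_le_trans (expR_gt0 _) zu; rewrite pmulr_lgt0// invr_gt0.
have un : u <= n%:R by rewrite ler_nat -[leqRHS]card_ord max_card.
have -> : n%:R * (a / 2 * expR (- (ell * z))) = (n%:R * a * expR (- (ell * z))) / 2.
  by ring.
have zell : expR (- (ell * z)) <= (u / n%:R) `^ ell.
  rewrite -mulrN mulrC expRM; apply: ge0_ler_powR => //.
  - by rewrite ltW// (lt_trans _ ell1).
  - by rewrite nnegrE expR_ge0.
  - by rewrite nnegrE divr_ge0// ltW.
apply: le_trans (few_uninformed_prob _ _ Q S (n%:R * a * expR (- (ell * z))) _ S0 _ _ _ covS) _.
- by rewrite !mulr_gt0// expR_gt0.
- by rewrite mulr_ge0// divr_ge0// exprn_ge0// ltW.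
- apply: le_trans _ (ler_wpM2l (ltW u0) pS).
  have -> : u * (a * (u / n%:R) `^ (ell - 1)) = n%:R * a * (u / n%:R) `^ ell.
    rewrite -(@mulr_powRB1 _ (u / n%:R) ell) ?(divr_ge0 (ltW u0) (ltW n0))//.
      by field; rewrite gt_eqF.
    by rewrite (lt_trans _ ell1).
  by rewrite ler_wpM2l// mulr_ge0// ltW.
rewrite -/u.
have -> : u + u ^+ 2 * (c * (n%:R / u ^+ 2)) = u + c * n%:R.
  by field; rewrite gt_eqF.
have -> : 4 * (1 + c) / a ^+ 2 / n%:R * expR (2 * (ell * z)) =
    4 * (n%:R + c * n%:R) / (n%:R * a * expR (- (ell * z))) ^+ 2.
  rewrite expRN mulrC mulr_natl mulr2n expRD.
  by field; rewrite !gt_eqF ?expR_gt0.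
rewrite ler_wpM2r ?invr_ge0 ?sqr_ge0//.
by rewrite ler_wpM2l// lerD2r.
Qed.

(** * Iteration over the rounds *)

Lemma card_uninformed (n : nat) (S : {set 'I_n}) : #|S| = (n - #|finset.setC S|)%N.
Proof. by rewrite cardsCs card_ord. Qed.

(* The thresholds [z t = A * ell ^+ t - B] satisfy [z t.+1 = ell * z t + (ell - 1) * B],
   where the last term absorbs the factor [a / 2] lost in each round. *)
Lemma run_reach_le (R : realType) (n : nat) (Q : rumor_process R n)
    (g alpha ell a c A B : R) (T : nat) (d : measure_display)
    (Omega : measurableType d) (P : probability Omega R)
    (X : nat -> Omega -> {set 'I_n}) (E : set Omega) :
  0 < g < 1 -> 1 < ell -> 0 < a -> 0 <= c -> 0 <= B ->
  - ln (a / 2) <= (ell - 1) * B -> A - B = ln (2 / g) ->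
  (forall u : nat, n%:R `^ (1 - alpha) <= u%:R <= g * n%:R ->
     1 - success_prob Q (n - u)%N >= a * (u%:R / n%:R) `^ (ell - 1) /\
     (covariance_number Q (n - u)%N <= (c * (n%:R / u%:R ^+ 2))%:E)%E) ->
  2 <= g * n%:R -> A * ell ^+ T < alpha * ln n%:R ->
  rumor_run Q (n - Num.truncn (g * n%:R))%N P X -> measurable E ->
  (forall w, E w -> exists2 t, (t <= T)%N &
     (n - Num.truncn (n%:R `^ (1 - alpha)) <= #|X t w|)%N) ->
  (P E <= (T%:R * (4 * (1 + c) / a ^+ 2 / n%:R * expR (2 * (A * ell ^+ T))))%:E)%E.
Proof.
move=> /andP[g0 g1] ell1 a0 c0 B0 aB AB HQ gn AT HX mE reachE.
have n0 : 0 < n%:R :> R by rewrite -(pmulr_rgt0 _ g0); lra.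
have gn_n : g * n%:R < n%:R by rewrite gtr_pMl.
have A0 : 0 < A.
  have : 0 < ln (2 / g) by apply: ln_gt0; rewrite ltr_pdivlMr//; lra.
  by rewrite -AB; lra.
have ell0 : 0 < ell by lra.
pose z t := A * ell ^+ t - B.
have zS t : z t.+1 = ell * z t + (ell - 1) * B by rewrite /z exprS; ring.
have AleT t : (t <= T)%N -> A * ell ^+ t <= A * ell ^+ T.
  by move=> tT; rewrite ler_wpM2l ?(ltW A0)// ler_weXn2l// ltW.
have above t : (t <= T)%N -> n%:R `^ (1 - alpha) < n%:R * expR (- z t).
  move=> tT; rewrite expR_powR_ln// -{2}(lnK (_ : n%:R \in Num.pos))//.
  rewrite -expRD ltr_expR /z; have := AleT _ tT; lra.
have tr_le : (Num.truncn (g * n%:R))%:R <= g * n%:R by rewrite truncn_le; lra.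
(* The second condition keeps the uninformed count in the range of (i) and (ii); it persists because
   nodes stay informed. *)
pose G t (S : {set 'I_n}) := (n%:R * expR (- z t) <= #|finset.setC S|%:R) &&
  (#|finset.setC S| <= Num.truncn (g * n%:R))%N.
apply: (run_leave_le _ _ Q _ _ _ P X T G _ E HX mE).
- move=> w /reachE[t tT mX]; exists t => //; apply/negP => /andP[low _].
  move: mX; rewrite card_uninformed; apply/negP; rewrite -ltnNge.
  have tu : (Num.truncn (n%:R `^ (1 - alpha)) < #|finset.setC (X t w)|)%N.
    rewrite truncn_lt_nat ?powR_ge0//; exact: lt_le_trans (above _ tT) low.
  have un : (#|finset.setC (X t w)| <= n)%N by rewrite -[leqRHS]card_ord max_card.
  exact: ltn_sub2l (leq_trans tu un) tu.
- by rewrite !mulr_ge0 ?invr_ge0 ?sqr_ge0 ?expR_ge0//; lra.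
(* By [A - B = ln (2 / g)] the threshold at time 0 is g n / 2, and the floor of g n exceeds g n - 1
   >= g n / 2. *)
- move=> S Sk; have tn : (Num.truncn (g * n%:R) <= n)%N.
    by rewrite -(ler_nat R); apply: le_trans tr_le (ltW _).
  have uE : #|finset.setC S| = Num.truncn (g * n%:R).
    have un : (#|finset.setC S| <= n)%N by rewrite -[leqRHS]card_ord max_card.
    by rewrite -(subKn un) -card_uninformed Sk subKn.
  rewrite /G uE leqnn andbT /z expr0 mulr1 AB expRN lnK ?posrE ?divr_gt0// invf_div.
  have := truncnS_gt (g * n%:R); rewrite -natr1; lra.
- move=> t S tT /andP[low up].
  have uP := lt_le_trans (above _ (ltnW tT)) low.
  have ugn : #|finset.setC S|%:R <= g * n%:R :> R.
    by apply: le_trans tr_le; rewrite ler_nat.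
  have [|pS covS] := HQ #|finset.setC S|; first by rewrite (ltW uP).
  have S0 : S != finset.set0.
    rewrite -card_gt0 card_uninformed subn_gt0 -(ltr_nat R).
    exact: le_lt_trans ugn gn_n.
  rewrite -card_uninformed in pS covS.
  have lowS : expR (- z t) <= #|finset.setC S|%:R / n%:R.
    by rewrite ler_pdivlMr// mulrC.
  have := one_round_few_uninformed_prob _ _ Q S ell a c (z t) ell1 a0 c0 S0 lowS pS covS.
  move=> few; apply: le_trans (le_trans few _); last first.
    rewrite ler_wpM2l//; first by rewrite !mulr_ge0 ?invr_ge0 ?sqr_ge0//; lra.
    rewrite ler_expR ler_wpM2l//; apply: le_trans (AleT t.+1 tT).
    have -> : A * ell ^+ t.+1 = ell * z t + ell * B by rewrite /z exprS; ring.
    by rewrite lerDl mulr_ge0// ltW.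
  (* A set [S'] of positive probability contains [S], so it can violate [G t.+1] only by having too
     few uninformed nodes. *)
  rewrite big_mkcond [leRHS]big_mkcond /=; apply: ler_sum => S' _.
  case: ifP => [nG|_]; last by case: ifP => // _; exact: round_law_ge0.
  case: ifP => // /negbT; rewrite -leNgt => many.
  rewrite stay_informed//; apply/negP => SS'; move: nG; apply/negP; rewrite negbK.
  apply/andP; split; last by apply: leq_trans up; rewrite subset_leq_card// finset.setCS.
  apply: le_trans many; rewrite ler_wpM2l ?(ltW n0)//.
  rewrite -[a / 2]lnK ?posrE ?divr_gt0// -expRD ler_expR zS; lra.
Qed.

(** * The lower tail of the spreading time *)

(** The exponent [eps] is left free because two values are needed: [2 * alpha * ell] for the tail
    claim and 1/2 for the expectation. *)
Lemma spread_time_lower_tail (R : realType) (g alpha ell a c eps : R)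
    (Q : forall n : nat, rumor_process R n) :
  0 < g < 1 -> 0 < alpha -> 1 < ell -> 0 < a -> 0 <= c -> 0 < eps ->
  (\forall n \near \oo, forall u : nat,
     n%:R `^ (1 - alpha) <= u%:R <= g * n%:R ->
       1 - success_prob (Q n) (n - u)%N >= a * (u%:R / n%:R) `^ (ell - 1) /\
       (covariance_number (Q n) (n - u)%N <= (c * (n%:R / u%:R ^+ 2))%:E)%E) ->
  exists r0 C : R, 0 <= C /\ forall r : R, r0 <= r ->
    \forall n \near \oo,
      forall (d : measure_display) (Omega : measurableType d)
             (P : probability Omega R) (X : nat -> Omega -> {set 'I_n}),
        rumor_run (Q n) (n - Num.truncn (g * n%:R))%N P X ->
        (P [set w | (spread_time R X (n - Num.truncn (n%:R `^ (1 - alpha)))%N w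
                       <= (logb ell (ln n%:R) - r)%:E)%E]
           <= (C * n%:R `^ (- 1 + eps))%:E)%E.
Proof.
move=> gI alpha0 ell1 a0 c0 eps0 HQ.
have /andP[g0 g1] := gI.
have ell0 : 0 < ell by lra.
have lnell : 0 < ln ell by exact: ln_gt0.
pose B : R := `|ln (a / 2)| / (ell - 1).
pose A : R := B + ln (2 / g).
have B0 : 0 <= B by rewrite divr_ge0//; lra.
have aB : - ln (a / 2) <= (ell - 1) * B.
  rewrite /B [leRHS]mulrC divfK; last by lra.
  by rewrite -normrN ler_norm.
have AB : A - B = ln (2 / g) by rewrite /A; ring.
have A0 : 0 < A.
  have : 0 < ln (2 / g) by apply: ln_gt0; rewrite ltr_pdivlMr//; lra.
  by rewrite /A; lra.
pose e := Num.min eps alpha.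
have e0 : 0 < e by rewrite lt_min eps0.
have [e_eps e_alpha] : e <= eps /\ e <= alpha by rewrite !ge_min !lexx orbT.
pose K : R := 4 * (1 + c) / a ^+ 2.
have K0 : 0 <= K by rewrite divr_ge0 ?sqr_ge0//; lra.
(* For [r] at least this value, [ell ^+ T] is at most [e / (2 * A + 1) * ln n%:R] whenever [T] is at
   most log_ell (ln n) - r. The divisor [ell - 1] comes from bounding [T] by Bernoulli's
   inequality. *)
exists (logb ell ((2 * A + 1) / e)), (K / (ell - 1)); split.
  by rewrite divr_ge0//; lra.
move=> r rr0; near=> n => d Omega P X HX.
have n1 : 1 < n%:R :> R by near: n; exact: nbhs_infty_gtr.
have n0 : 0 < n%:R :> R by lra.
have gn : 2 <= g * n%:R.
  by rewrite mulrC -ler_pdivrMr//; near: n; exact: nbhs_infty_ger.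
have HQn : forall u : nat, n%:R `^ (1 - alpha) <= u%:R <= g * n%:R ->
     1 - success_prob (Q n) (n - u)%N >= a * (u%:R / n%:R) `^ (ell - 1) /\
     (covariance_number (Q n) (n - u)%N <= (c * (n%:R / u%:R ^+ 2))%:E)%E by near: n.
have lnn : 0 < ln n%:R :> R by exact: ln_gt0.
set m := (n - Num.truncn (n%:R `^ _))%N; set b := logb ell (ln n%:R) - r.
have mE := spread_time_le_measurable _ _ _ _ _ _ _ _ m b HX.
(* For negative [b] the event is empty; otherwise its floor [T] is the last round to consider. *)
have [bneg|b0] := ltP b 0.
  rewrite [X in P X](_ : _ = set0).
    by rewrite measure0 lee_fin mulr_ge0 ?powR_ge0// divr_ge0//; lra.
  apply/seteqP; split => w //= /spread_time_le[t tb _].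
  by have := le_lt_trans tb bneg; rewrite ltNge ler0n.
pose T := Num.truncn b.
have Tb : T%:R <= b by rewrite truncn_le.
have leT t : t%:R <= b -> (t <= T)%N by rewrite truncn_ge_nat.
clearbody T.
have ellT : (2 * A + 1) * ell ^+ T <= e * ln n%:R.
  have : ell ^+ T <= ln n%:R * (e / (2 * A + 1)).
    rewrite -powR_mulrn ?(ltW ell0)// expR_powR_ln//.
    rewrite -[leRHS]lnK ?posrE ?mulr_gt0 ?invr_gt0//; last by lra.
    rewrite ler_expR -ler_pdivlMr// lnM ?posrE ?divr_gt0//; last by lra.
    rewrite mulrDl -/(logb ell (ln n%:R)).
    apply: le_trans Tb _; rewrite lerD2l lerNl; apply: le_trans rr0.
    rewrite /logb -mulNr -lnV ?posrE ?divr_gt0 ?invf_div//; lra.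
  rewrite mulrA ler_pdivlMr; last by lra.
  by rewrite [leLHS]mulrC [leRHS]mulrC.
have ellT1 : 1 <= ell ^+ T by rewrite exprn_ege1// ltW.
apply: le_trans (run_reach_le _ _ (Q n) g alpha ell a c A B T _ _ P X _ gI ell1 a0 c0 B0
  aB AB HQn gn _ HX mE _) _.
- have : e * ln n%:R <= alpha * ln n%:R by rewrite ler_wpM2r// ltW.
  have : 0 <= A * ell ^+ T by rewrite mulr_ge0// ltW// (lt_le_trans _ ellT1).
  by lra.
- by move=> w /= /spread_time_le[t tb mt]; exists t => //; exact: leT.
rewrite lee_fin -/K.
(* The factor [T] of the union bound costs one more [ell ^+ T] in the exponent, whence the [+ 1] in
   [2 * A + 1]. *)
have Tell : T%:R <= expR (ell ^+ T) / (ell - 1).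
  rewrite ler_pdivlMr; last by lra.
  have := bernoulli_ineq _ ell T ell1; have := expR_ge1Dx (ell ^+ T); lra.
apply: le_trans (ler_wpM2r _ Tell) _.
  exact: mulr_ge0 (divr_ge0 K0 (ltW n0)) (expR_ge0 _).
have -> : expR (ell ^+ T) / (ell - 1) * (K / n%:R * expR (2 * (A * ell ^+ T))) =
    K / (ell - 1) * (n%:R^-1 * expR ((2 * A + 1) * ell ^+ T)).
  have -> : (2 * A + 1) * ell ^+ T = 2 * (A * ell ^+ T) + ell ^+ T by ring.
  rewrite expRD; field.
  by rewrite gt_eqF//= subr_eq0 gt_eqF.
rewrite ler_wpM2l//; first by rewrite divr_ge0//; lra.
rewrite powRD; last by rewrite (gt_eqF n0) implybT.
rewrite powR_inv1 ?(ltW n0)// ler_wpM2l ?invr_ge0 ?(ltW n0)//.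
rewrite expR_powR_ln// ler_expR; apply: le_trans ellT _.
by rewrite ler_wpM2r// ltW.
Unshelve. all: by end_near.
Qed.

(** * From the tail bound to both claims *)

Theorem theorem48 (R : realType) (g alpha ell a c : R)
  (Hg : 0 < g < 1) (Halpha : 0 < alpha <= 1) (Hell : 1 < ell)
  (Ha : 0 < a) (Hc : 0 <= c)
  (Q : forall n : nat, rumor_process R n)
  (HQ : \forall n \near \oo, forall u : nat,
     n%:R `^ (1 - alpha) <= u%:R <= g * n%:R ->
       1 - success_prob (Q n) (n - u)%N >= a * (u%:R / n%:R) `^ (ell - 1) /\
       (covariance_number (Q n) (n - u)%N <= (c * (n%:R / u%:R ^+ 2))%:E)%E) :
  (exists C : R, \forall n \near \oo,
     forall (d : measure_display) (Omega : measurableType d)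
            (P : probability Omega R) (X : nat -> Omega -> {set 'I_n}),
       rumor_run (Q n) (n - Num.truncn (g * n%:R))%N P X ->
       (\int[P]_w spread_time R X (n - Num.truncn (n%:R `^ (1 - alpha)))%N w
          >= (logb ell (ln n%:R) - C)%:E)%E)
  /\
  (exists r0 : R, forall r : R, r0 <= r ->
     exists C : R, \forall n \near \oo,
       forall (d : measure_display) (Omega : measurableType d)
              (P : probability Omega R) (X : nat -> Omega -> {set 'I_n}),
         rumor_run (Q n) (n - Num.truncn (g * n%:R))%N P X ->
         (P [set w | (spread_time R X (n - Num.truncn (n%:R `^ (1 - alpha)))%N w
                        <= (logb ell (ln n%:R) - r)%:E)%E]
            <= (C * n%:R `^ (- 1 + 2 * alpha * ell))%:E)%E).
Proof.
have /andP[alpha0 _] := Halpha.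
have ell0 : 0 < ell by lra.
have lnell : 0 < ln ell by exact: ln_gt0.
have tail eps (eps0 : 0 < eps) := spread_time_lower_tail _ _ _ _ _ _ _ _
  Hg alpha0 Hell Ha Hc eps0 HQ.
split; last first.
  have [|r0 [C [_ HC]]] := tail (2 * alpha * ell); first by rewrite !mulr_gt0.
  by exists r0 => r rr0; exists C; exact: HC.
(* With [eps] = 1/2 the event that the time is at most [b] has probability O(n^(-1/2)), while [b] is
   O(n^(1/2)). The expectation thus loses only a constant against [b]. *)
have [|r0 [K [K0 HK]]] := tail 2^-1; first by rewrite invr_gt0.
pose r := Num.max r0 0.
have [r0r r_ge0] : r0 <= r /\ 0 <= r by rewrite !le_max !lexx orbT.
exists (r + 2 / ln ell * K).
apply: filterS2 (nbhs_infty_gtr (1 : R)) (HK r r0r) => n n1 HKn d Omega P X HX.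
have n0 : 0 < n%:R :> R by lra.
have lnn : 0 < ln n%:R :> R by exact: ln_gt0.
have PK := HKn d Omega P X HX.
set m := (n - Num.truncn (n%:R `^ _))%N in PK *; set b := logb ell (ln n%:R) - r in PK *.
have T0 w : (0 <= spread_time R X m w)%E.
  by apply/ereal_infP => _ [t _ <-]; rewrite lee_fin.
have -> : logb ell (ln n%:R) - (r + 2 / ln ell * K) = b - 2 / ln ell * K.
  by rewrite /b; ring.
have lK : 0 <= 2 / ln ell * K by rewrite mulr_ge0// divr_ge0// ltW.
have [bneg|b0] := ltP b 0.
  by apply: (@le_trans _ _ 0%E); [rewrite lee_fin; lra|exact: integral_ge0].
(* From ln y <= y - 1, applied to y = ln n and to y = n^(1/2): ln (ln n) <= ln n = 2 ln (n^(1/2)) <=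
   2 n^(1/2). *)
have bn : b <= 2 / ln ell * n%:R `^ 2^-1.
  rewrite mulrAC ler_pdivlMr// /b mulrBl /logb divfK ?gt_eqF//.
  have := le_ln1Dx (_ : -1 < ln n%:R - 1 :> R); have := le_ln1Dx (_ : -1 < n%:R `^ 2^-1 - 1 :> R).
  have := powR_gt0 2^-1 n0.
  rewrite ![1 + (_ - 1)]addrC !subrK ln_powR.
  have := mulr_ge0 r_ge0 (ltW lnell).
  move=> h1 h2 h3 h4.
  have := h3 ltac:(lra); have := h4 ltac:(lra); lra.
have mE := spread_time_le_measurable _ _ _ _ _ _ _ _ m b HX.
have mT := spread_time_measurable _ _ _ _ _ _ _ _ m HX.
set E := [set w | _] in PK mE.
(* Outside [E] the time exceeds [b], so the expectation is at least [b] times the probability of the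
   complement of [E]. *)
apply: (@le_trans _ _ (\int[P]_(w in ~` E) b%:E)%E); last first.
  apply: (@le_trans _ _ (\int[P]_(w in ~` E) spread_time R X m w)%E).
    apply: ge0_le_integral => //; first exact: measurableC.
    - exact: measurable_funS mT.
    - by move=> w /negP; rewrite -ltNge => /ltW.
  by apply: ge0_subset_integral => //; exact: measurableC.
rewrite integral_cst; last exact: measurableC.
rewrite [X in (_ * X)%E](probability_setC P mE).
have PEfin : P E \is a fin_num by exact: fin_num_measure.
rewrite -(fineK PEfin).
rewrite -EFinB -EFinM lee_fin mulrBr mulr1 lerD2l lerN2.
have PE : fine (P E) <= K * n%:R `^ (-1 + 2^-1).
  rewrite -lee_fin (fineK PEfin). exact: PK.
apply: le_trans (ler_wpM2l b0 PE) _.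
apply: le_trans (ler_wpM2r _ bn) _; first by rewrite mulr_ge0// powR_ge0.
rewrite mulrACA -powRD; last by rewrite (gt_eqF n0) implybT.
by rewrite (_ : _ + _ = 0) ?powRr0 ?mulr1//; lra.
Qed.
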